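(* Let $\mu$ be the Glasner-Weiss measure on the Borel algebra of the space $\mathcal{M}$ of total orders on $\mathbb{N}$, and let $(T_i)_{i\in\mathbb{N}}$ be a recursive representation of the algebra $\mathcal{Z}$ of subsets of $\mathcal{M}$ generated by the cylinder sets. There is an effective procedure (algorithm) that yields, for any given $i,k\in\mathbb{N}$, a binary rational $\beta_k$ (depending on $i$ and $k$) such that $$|\mu(T_i)-\beta_k|<2^{-k}.$$
   Context: $\mathcal{M}$ is the set of (strict) total orders on $\mathbb{N}$, identified with a closed subset of the compact product space $\{0,1\}^{(\mathbb{N}\times\mathbb{N})_{\neq}}$, where $(\mathbb{N}\times\mathbb{N})_{\neq}$ is the set of pairs $(i,j)$ with $i\neq j$: a total order $<$ corresponds to $\xi$ with $\xi(x,y)=1\Leftrightarrow x<y$, and one writes $<_\xi$ for the order associated with $\xi$. $S_\infty$ is the group of all permutations of $\mathbb{N}$ with the topology of pointwise convergence; it acts continuously on $\mathcal{M}$ by $x<_{\sigma\xi}y\Leftrightarrow \sigma^{-1}x<_\xi\sigma^{-1}y$. The Glasner-Weiss measure $\mu$ is the unique $S_\infty$-invariant Borel probability measure on $\mathcal{M}$ (its existence and uniqueness are known). $\mathcal{M}_f$ is the set of total orders on finite subsets of $\mathbb{N}$. For $\ell\in\mathcal{M}_f$, the cylinder set $Z_\ell$ is the set of $\xi\in\mathcal{M}$ extending $\ell$. $\mathcal{Z}$ is the algebra of subsets of $\mathcal{M}$ generated by the sets $Z_\ell$, $\ell\in\mathcal{M}_f$. For a cylinder set $Z$ write $Z^1=Z$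 and $Z^0=\mathcal{M}\setminus Z$. A recursive representation of $\mathcal{Z}$ is an enumeration $(T_i)_{i\in\mathbb{N}}$ of $\mathcal{Z}$ such that from a given $i$ one can effectively retrieve an expression of $T_i$ as a finite union of sets of the form $Z_{\ell_1}^{\delta_1}\cap\cdots\cap Z_{\ell_k}^{\delta_k}$ with each $\ell_j\in\mathcal{M}_f$ and $\delta_j\in\{0,1\}$. A binary rational is a rational number whose denominator is a power of $2$. *)

(* Defs.v *)
From HB Require Import structures.
From mathcomp Require Import all_boot all_order all_algebra finmap.
From mathcomp Require Import all_classical all_reals all_analysis.

Set Implicit Arguments.
Unset Strict Implicit.
Unset Printing Implicit Defensive.

Import Order.TTheory GRing.Theory Num.Theory.

Local Open Scope classical_set_scope.

(* Kleene's class of total recursive functions: it contains the basic functions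
   and is closed under composition, primitive recursion and minimization of
   regular functions (those with a zero in the first variable for all values of
   the other ones).  The last two constructors characterize the new function
   [h] by its defining equations. *)
Inductive recursive : forall n : nat, (n.-tuple nat -> nat) -> Prop :=
| rec_zero n : recursive (fun _ : n.-tuple nat => 0)
| rec_succ : recursive (fun v : 1.-tuple nat => (tnth v ord0).+1)
| rec_proj n (i : 'I_n) : recursive (fun v : n.-tuple nat => tnth v i)
| rec_comp n m (f : n.-tuple nat -> nat) (g : 'I_n -> m.-tuple nat -> nat) :
    recursive f -> (forall i, recursive (g i)) ->
    recursive (fun v : m.-tuple nat => f [tuple g i v | i < n])
| rec_prim n (f : n.-tuple nat -> nat) (g : n.+2.-tuple nat -> nat)
    (h : n.+1.-tuple nat -> nat) :
    recursive f -> recursive g ->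
    (forall v : n.-tuple nat, h [tuple of 0 :: v] = f v) ->
    (forall k (v : n.-tuple nat),
       h [tuple of k.+1 :: v] = g [tuple of k :: h [tuple of k :: v] :: v]) ->
    recursive h
| rec_min n (f : n.+1.-tuple nat -> nat) (h : n.-tuple nat -> nat) :
    recursive f ->
    (forall v : n.-tuple nat, f [tuple of h v :: v] = 0) ->
    (forall (v : n.-tuple nat) y, y < h v -> f [tuple of y :: v] <> 0) ->
    recursive h.

(* The algorithm outputs a sign, a numerator and the exponent of the
   denominator; the fraction need not be reduced. *)
Definition recursive_dyadic (beta : nat -> nat -> rat) : Prop :=
  exists s p e : 2.-tuple nat -> nat,
    [/\ recursive s, recursive p, recursive e &
      forall i k : nat, beta i k =
        ((-1) ^+ s [tuple i; k] * (p [tuple i; k])%:R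
           / 2%:R ^+ e [tuple i; k])%R].

Definition strict_total_on (D : {pred nat}) (r : rel nat) : Prop :=
  [/\ {in D, irreflexive r}, {in D & &, transitive r} &
      {in D &, forall x y, x != y -> r x y || r y x}].

Definition offdiag : Type := {p : nat * nat | p.1 != p.2}.

Definition lt_of (xi : offdiag -> bool) : rel nat :=
  fun x y => if insub (x, y) is Some p then xi p else false.

Definition total_orders : set {ptws offdiag -> bool} :=
  [set xi | strict_total_on predT (lt_of xi)].

(* As a [set_type], it carries the subspace topology. *)
Definition M : Type := set_type total_orders.

HB.instance Definition _ := Topological.on M.

Lemma total_orders_ltn :
  total_orders (fun p : offdiag => (val p).1 < (val p).2).
Proof.
have E x y :
    lt_of (fun p : offdiag => (val p).1 < (val p).2) x y = (x < y).
  rewrite /lt_of; case: insubP => [p _ -> //|/=].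
  by rewrite negbK => /eqP ->; rewrite ltnn.
split=> [x _|y x z _ _ _|x y _ _]; rewrite !E ?ltnn //.
  exact: ltn_trans.
by rewrite neq_ltn.
Qed.

HB.instance Definition _ := isPointed.Build M (SigSub (mem_set total_orders_ltn)).

Definition lt_M (xi : M) : rel nat := lt_of (val xi).

Definition BorelM : measurableType (@open M).-sigma :=
  g_sigma_algebraType (@open M).

Record Sinfty := MkSinfty {
  sfun :> nat -> nat;
  sinv : nat -> nat;
  sfunK : cancel sfun sinv;
  sinvK : cancel sinv sfun }.

Definition act_fun (s : Sinfty) (xi : offdiag -> bool) : offdiag -> bool :=
  fun p => lt_of xi (sinv s (val p).1) (sinv s (val p).2).

Lemma lt_of_act_fun (s : Sinfty) (xi : offdiag -> bool) (x y : nat) :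
  lt_of (act_fun s xi) x y = lt_of xi (sinv s x) (sinv s y).
Proof.
rewrite {1}/lt_of; case: insubP => [p _ Ep|/=]; first by rewrite /act_fun Ep.
by rewrite negbK => /eqP ->; rewrite /lt_of insubF //= eqxx.
Qed.

Lemma total_orders_act (s : Sinfty) (xi : M) : total_orders (act_fun s (val xi)).
Proof.
have [irr tr tot] : total_orders (val xi) by exact: (set_mem (valP xi)).
split=> [x _|y x z _ _ _|x y _ _ xy]; rewrite !lt_of_act_fun.
- exact: irr.
- exact: tr.
- by apply: tot => //; rewrite (can_eq (sinvK s)).
Qed.

Definition act (s : Sinfty) (xi : M) : M :=
  SigSub (mem_set (total_orders_act s xi)).

(* The Glasner-Weiss measure is the only probability measure with this
   property. *)
Definition glasner_weiss (R : realType) (mu : probability BorelM R) : Prop :=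
  forall (s : Sinfty) (A : set BorelM), measurable A -> mu (act s @` A) = mu A.

(* Only the restriction of [fo_lt] to [fo_dom] is relevant. *)
Record Mf := MkMf {
  fo_dom : {fset nat};
  fo_lt : rel nat;
  fo_total : strict_total_on (mem fo_dom) fo_lt }.

Definition cylinder (l : Mf) : set M :=
  [set xi | {in fo_dom l &, forall x y, fo_lt l x y -> lt_M xi x y}].

Definition set_algebra (T : Type) (G : set (set T)) : Prop :=
  [/\ G set0, setC_closed G & setU_closed G].

Definition Zalg : set (set M) := smallest (@set_algebra M) (range cylinder).

(* A literal (l, d) stands for Z_l^d, a clause for the intersection of its
   literals, an expression for the union of its clauses. *)
Definition literal : Type := (Mf * bool)%type.
Definition expression : Type := seq (seq literal).

Definition literal_set (q : literal) : set M :=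
  if q.2 then cylinder q.1 else ~` cylinder q.1.

Definition expression_set (e : expression) : set M :=
  \big[setU/set0]_(c <- e) \big[setI/setT]_(q <- c) literal_set q.

(* The elements of the domain of l, listed in l-increasing order. *)
Definition listing (l : Mf) : seq nat :=
  sort (fun x y => (x == y) || fo_lt l x y) (fo_dom l).

(* Goedel numbers, from the bijection [CodeSeq.code : seq nat -> nat]. *)
Definition code_literal (q : literal) : nat :=
  CodeSeq.code ((q.2 : nat) :: listing q.1).

Definition code_expression (e : expression) : nat :=
  CodeSeq.code [seq CodeSeq.code [seq code_literal q | q <- c] | c <- e].

(* Repetitions in the enumeration are allowed. *)
Definition recursive_representation (T : nat -> set M) : Prop :=
  range T = Zalg /\
  exists f : 1.-tuple nat -> nat, recursive f /\
    forall i : nat, exists e : expression,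
      f [tuple i] = code_expression e /\ T i = expression_set e.

(* Main.v *)
Require Import Defs.
From mathcomp Require Import fingroup perm.
From mathcomp Require Import all_boot all_order all_algebra finmap.
From mathcomp Require Import all_classical all_reals all_analysis.

(** An expression over cylinder sets mentions finitely many labels, all of them
below [n.+1] for some [n], so whether a total order [xi] belongs to the set it
denotes depends only on how [xi] orders the labels [0, ..., n].  There are
[(n.+1)`!] such orders; the corresponding cells partition the space of total
orders, and the permutations of the labels (extended by the identity) permute
these cells transitively.  An invariant probability measure therefore gives all
of them the same mass [1 / (n.+1)`!], and the measure of the set is the rational
number

    (number of orders of [0, ..., n] that satisfy the expression) / (n.+1)`!

([measure_expression]).  This number is computable: one can take for [n] the
Goedel number of the expression itself, because every label is smaller than the
code in which it occurs, and then count by brute force.  The orders are run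
through as the integers [c < N ^ N], with [N = n.+1], the digit of [c] of index
[x] in base [N] being the position of the label [x]; the integers whose digits
are pairwise distinct are the orders ([arrangementsE]).  Truncating the resulting
fraction to [k] binary digits leaves an error strictly smaller than [2 ^- k].

Recursiveness of the count is obtained from closure properties of the class of
recursive functions.  In order to handle local variables, a function of any
number of arguments is seen as a function of an environment, a list of natural
numbers in which the variable bound last comes first and the variables out of
range are [0] ([recseq]).  The proof that the count is recursive then follows
its definition, which only uses arithmetic, bounded sums and quantifiers, and
the decoding of lists ([recseq_arrangements]). *)

Set Implicit Arguments.
Unset Strict Implicit.
Unset Printing Implicit Defensive.

Import Order.TTheory GRing.Theory Num.Theory.
Import CodeSeq.

Local Open Scope nat_scope.

(** * Recursive functions of an environment *)

(** Functions of a list, rather than of a tuple of given size, spare all the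
dependent types: binding a variable is just adding an entry to the list. *)
Definition recseq (F : seq nat -> nat) : Prop :=
  forall n, recursive (fun v : n.-tuple nat => F v).

Lemma recursive_ext n (f g : n.-tuple nat -> nat) :
  f =1 g -> recursive f -> recursive g.
Proof. by move=> /funext ->. Qed.

Lemma recseq_ext (F G : seq nat -> nat) : F =1 G -> recseq F -> recseq G.
Proof. by move=> /funext ->. Qed.

Lemma recseq_var i : recseq (fun s => nth 0 s i).
Proof.
move=> n; have [lt_in|le_ni] := ltnP i n.
  apply: (recursive_ext _ (rec_proj (Ordinal lt_in))) => v.
  by rewrite (tnth_nth 0).
by apply: (recursive_ext _ (rec_zero n)) => v; rewrite nth_default ?size_tuple.
Qed.

(** The condition on sizes makes the arity of [F] depend only on the arity of the
composite function, as composition of functions of tuples requires. *)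
Lemma recseq_subst (F : seq nat -> nat) (S : seq nat -> seq nat) :
  recseq F -> (forall s t, size s = size t -> size (S s) = size (S t)) ->
  (forall i, recseq (fun s => nth 0 (S s) i)) ->
  recseq (fun s => F (S s)).
Proof.
move=> rF sizeS rS n; set m := size (S (nseq n 0)).
pose g (i : 'I_m) (v : n.-tuple nat) := nth 0 (S v) i.
apply: (recursive_ext _ (rec_comp (g := g) (rF m) _)) => [v|i]; last exact: rS.
have sizeSv : size (S v) = m by apply: sizeS; rewrite size_tuple size_nseq.
congr F; apply: (@eq_from_nth _ 0); rewrite size_tuple ?sizeSv //.
by move=> i lt_i; rewrite (nth_mktuple _ _ (Ordinal lt_i)).
Qed.

Lemma recseq_drop d (F : seq nat -> nat) :
  recseq F -> recseq (fun s => F (drop d s)).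
Proof.
move=> rF; apply: (recseq_subst rF) => [s t|i]; first by rewrite !size_drop => ->.
by apply: (recseq_ext _ (recseq_var (d + i))) => s; rewrite nth_drop.
Qed.

(** In this rule and in the binding rules below, the body [f] is evaluated in an
environment that starts with the bound variable; hence the arguments [nth 0 s 0]
and [drop 1 s].  The parameter [d] here discards the variables bound between [f]
and the place where its variable receives a value, which [f] must not see. *)
Lemma recseq_let d (f : nat -> seq nat -> nat) (G : seq nat -> nat) :
  recseq (fun s => f (nth 0 s 0) (drop 1 s)) -> recseq G ->
  recseq (fun s => f (G s) (drop d s)).
Proof.
move=> rf rG.
apply: (recseq_ext (F := fun s => f (nth 0 (G s :: drop d s) 0)
  (drop 1 (G s :: drop d s)))); first by move=> s /=; rewrite drop0.
apply: (recseq_subst (S := fun s => G s :: drop d s) rf) => [s t|[|i]] //=.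
  by rewrite !size_drop => ->.
by apply: (recseq_ext _ (recseq_var (d + i))) => s; rewrite nth_drop.
Qed.

Lemma recseq_prim (F G : seq nat -> nat) (H : nat -> seq nat -> nat)
    (B : seq nat -> nat) :
  recseq F -> recseq G -> (forall s, H 0 s = F s) ->
  (forall k s, H k.+1 s = G (k :: H k s :: s)) ->
  recseq B -> recseq (fun s => H (B s) s).
Proof.
move=> rF rG H0 HS rB.
pose h (t : seq nat) := H (nth 0 t 0) (drop 1 t).
suff rh : recseq h.
  by apply: (recseq_ext _ (recseq_let 0 rh rB)) => s; rewrite drop0.
case=> [|n].
  (* Arity 0 is not primitive recursion: the missing argument reads as 0. *)
  by apply: (recursive_ext _ (rF 0)) => v; rewrite tuple0 /h /= H0.
apply: (@rec_prim _ _ _ (h : n.+1.-tuple nat -> nat) (rF n) (rG n.+2)) => [v|k v].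
  by rewrite /h /= drop0 H0.
by rewrite /h /= drop0 HS.
Qed.

Lemma recseq_iter (f : nat -> seq nat -> nat) (F B : seq nat -> nat) :
  recseq (fun s => f (nth 0 s 0) (drop 1 s)) -> recseq F -> recseq B ->
  recseq (fun s => iter (B s) (f^~ s) (F s)).
Proof.
move=> rf rF rB.
apply: (recseq_prim (H := fun k s => iter k (f^~ s) (F s))
  (G := fun u => f (nth 0 u 1) (drop 2 u)) rF _ _ _ rB) => [|//|k s] /=.
  exact/(recseq_let 2 rf)/recseq_var.
by rewrite drop0.
Qed.

Lemma recseq_succ (F : seq nat -> nat) : recseq F -> recseq (fun s => (F s).+1).
Proof.
move=> rF n.
apply: (recursive_ext _ (rec_comp (g := fun _ v => F v) rec_succ _)) => [v|i].
  by rewrite tnth_mktuple.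
exact: rF.
Qed.

Lemma recseq_const c : recseq (fun=> c).
Proof. by elim: c => [n|c /recseq_succ //]; apply: rec_zero. Qed.

Lemma recseq_add (F G : seq nat -> nat) :
  recseq F -> recseq G -> recseq (fun s => F s + G s).
Proof.
move=> rF rG; apply: (recseq_ext (F := fun s => iter (F s) succn (G s))).
  by move=> s; rewrite iter_succn addnC.
apply: (recseq_iter (f := fun x _ => x.+1)) => //.
exact/recseq_succ/recseq_var.
Qed.

Lemma recseq_mul (F G : seq nat -> nat) :
  recseq F -> recseq G -> recseq (fun s => F s * G s).
Proof.
move=> rF rG; apply: (recseq_ext (F := fun s => iter (F s) (addn (G s)) 0)).
  by move=> s; rewrite iter_addn_0 mulnC.
apply: (recseq_iter (f := fun x s => G s + x)) => //; last exact: recseq_const.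
by apply: recseq_add; [apply: recseq_drop|apply: recseq_var].
Qed.

Lemma recseq_exp (F G : seq nat -> nat) :
  recseq F -> recseq G -> recseq (fun s => F s ^ G s).
Proof.
move=> rF rG; apply: (recseq_ext (F := fun s => iter (G s) (muln (F s)) 1)).
  by move=> s; rewrite iter_muln_1.
apply: (recseq_iter (f := fun x s => F s * x)) => //; last exact: recseq_const.
by apply: recseq_mul; [apply: recseq_drop|apply: recseq_var].
Qed.

Lemma recseq_pred (F : seq nat -> nat) : recseq F -> recseq (fun s => (F s).-1).
Proof.
move=> rF; apply: (recseq_prim (H := fun k _ => k.-1)
  (recseq_const 0) (recseq_var 0)) => //.
Qed.

Lemma recseq_sub (F G : seq nat -> nat) :
  recseq F -> recseq G -> recseq (fun s => F s - G s).
Proof.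
move=> rF rG; apply: (recseq_ext (F := fun s => iter (G s) predn (F s))).
  by move=> s; rewrite iter_predn.
apply: (recseq_iter (f := fun x _ => x.-1)) => //.
exact/recseq_pred/recseq_var.
Qed.

Lemma recseq_sum (f : nat -> seq nat -> nat) (B : seq nat -> nat) :
  recseq (fun s => f (nth 0 s 0) (drop 1 s)) -> recseq B ->
  recseq (fun s => \sum_(i < B s) f i s).
Proof.
move=> rf rB.
apply: (recseq_prim (H := fun k s => \sum_(i < k) f i s) (recseq_const 0)
  (G := fun s => nth 0 s 1 + f (nth 0 s 0) (drop 2 s))) => //.
- apply: recseq_add; first exact: recseq_var.
  exact/(recseq_let 2 rf)/recseq_var.
- by move=> s; rewrite big_ord0.
- by move=> k s; rewrite big_ord_recr /= drop0.
Qed.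

Lemma recseq_eq0 (F : seq nat -> nat) : recseq F -> recseq (fun s => F s == 0).
Proof.
move=> rF; apply: (recseq_ext (F := fun s => 1 - F s)).
  by move=> s; case: (F s).
by apply: recseq_sub => //; apply: recseq_const.
Qed.

Lemma recseq_leq (F G : seq nat -> nat) :
  recseq F -> recseq G -> recseq (fun s => F s <= G s).
Proof. by move=> rF rG; apply/recseq_eq0/recseq_sub. Qed.

Lemma recseq_ltn (F G : seq nat -> nat) :
  recseq F -> recseq G -> recseq (fun s => F s < G s).
Proof. by move=> rF rG; apply/recseq_leq/rG/recseq_succ. Qed.

Lemma recseq_and (P Q : seq nat -> bool) :
  recseq P -> recseq Q -> recseq (fun s => P s && Q s).
Proof.
move=> rP rQ; apply: (recseq_ext (F := fun s => P s * Q s)).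
  by move=> s; rewrite mulnb.
exact: recseq_mul.
Qed.

Lemma recseq_neg (P : seq nat -> bool) : recseq P -> recseq (fun s => ~~ P s).
Proof.
move=> /recseq_eq0; apply: recseq_ext => s; by case: (P s).
Qed.

Lemma recseq_imply (P Q : seq nat -> bool) :
  recseq P -> recseq Q -> recseq (fun s => P s ==> Q s).
Proof.
move=> rP rQ; apply: (recseq_ext (F := fun s => ~~ (P s && ~~ Q s))).
  by move=> s; case: (P s) (Q s) => [] [].
by apply: recseq_neg; apply: recseq_and rP _; apply: recseq_neg.
Qed.

Lemma recseq_eq (F G : seq nat -> nat) :
  recseq F -> recseq G -> recseq (fun s => F s == G s).
Proof.
move=> rF rG; apply: (recseq_ext (F := fun s => (F s <= G s) && (G s <= F s))).
  by move=> s; rewrite eqn_leq.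
by apply: recseq_and; apply: recseq_leq.
Qed.

Lemma recseq_forall (P : nat -> seq nat -> bool) (B : seq nat -> nat) :
  recseq (fun s => P (nth 0 s 0) (drop 1 s)) -> recseq B ->
  recseq (fun s => [forall i : 'I_(B s), P i s]).
Proof.
move=> rP rB.
apply: (recseq_ext (F := fun s => \sum_(i < B s) ~~ P i s == 0)).
  move=> s; rewrite sum_nat_eq0; congr nat_of_bool.
  by apply: eq_forallb => i; rewrite eqb0 negbK.
apply: recseq_eq0; apply: (recseq_sum (f := fun i s => ~~ P i s)) => //.
exact: (recseq_neg rP).
Qed.

Lemma recseq_div (F G : seq nat -> nat) :
  recseq F -> recseq G -> recseq (fun s => F s %/ G s).
Proof.
move=> rF rG.
(* The quotient of [m] by [d > 0] is the number of positive multiples of [d] up to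
   [m]; the factor [0 < G s] deals with division by 0. *)
apply: (recseq_ext
  (F := fun s => (0 < G s) * \sum_(i < F s) (i.+1 * G s <= F s))).
  move=> s; case: (posnP (G s)) => [->|d_gt0]; rewrite ?divn0 // mul1n.
  set m := F s; set d := G s in d_gt0 *.
  rewrite (eq_bigr (fun i : 'I_m => (i < m %/ d : nat))) => [|i _].
    by rewrite -big_mkcond (big_ord_narrow (leq_div m d)) /= sum1_card card_ord.
  by rewrite leq_divRL.
apply: recseq_mul; first by apply: recseq_ltn => //; apply: recseq_const.
apply: (recseq_sum (f := fun i s => i.+1 * G s <= F s)) => //.
apply: recseq_leq; last exact: recseq_drop.
by apply: recseq_mul; [apply/recseq_succ/recseq_var|apply: recseq_drop].
Qed.

Lemma recseq_mod (F G : seq nat -> nat) :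
  recseq F -> recseq G -> recseq (fun s => F s %% G s).
Proof.
move=> rF rG; apply: (recseq_ext (F := fun s => F s - F s %/ G s * G s)).
  by move=> s; rewrite {1}(divn_eq (F s) (G s)) addKn.
by apply/recseq_sub/recseq_mul/rG/recseq_div.
Qed.

Lemma recseq_fact (F : seq nat -> nat) : recseq F -> recseq (fun s => (F s)`!).
Proof.
apply: (recseq_prim (H := fun k _ => k`!) (G := fun s => (nth 0 s 0).+1 * nth 0 s 1)
  (recseq_const 1)) => //.
by apply: recseq_mul; [apply/recseq_succ|]; apply: recseq_var.
Qed.

Lemma recseq_recursive1 (f : 1.-tuple nat -> nat) : recursive f ->
  recseq (fun s => f [tuple nth 0 s 0]).
Proof.
move=> rf n.
apply: (recursive_ext _ (rec_comp (g := fun _ v => nth 0 v 0) rf _)) => [v|i].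
  by congr f; apply: eq_from_tnth => i; rewrite tnth_mktuple ord1.
exact: recseq_var.
Qed.

(** * Decoding of lists *)

Lemma logn2_code n s : logn 2 (code (n :: s)) = n.
Proof.
rewrite /= lognM ?expn_gt0 // pfactorK // logn_coprime ?addn0 //.
by rewrite coprime2n /= odd_double.
Qed.

(** The head of a list is the exponent of 2 in its code, that is the number of
[k > 0] such that [2 ^ k] divides the code.  Bounding [k] by the code makes the
count 0 for the empty list, of code 0. *)
Lemma recseq_head_decode (F : seq nat -> nat) :
  recseq F -> recseq (fun s => head 0 (decode (F s))).
Proof.
move=> rF.
apply: (recseq_ext (F := fun s => \sum_(k < F s) (F s %% 2 ^ k.+1 == 0))).
  move=> s; move: (F s) => m0; rewrite -[m0]decodeK codeK; case: (decode m0) => [|n t].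
    by rewrite big_ord0.
  rewrite -[RHS](logn2_code n t) logn_count_dvd // big_add1.
  have : 0 < code (n :: t) by rewrite muln_gt0 expn_gt0.
  case: (code (n :: t)) => // m _.
  have Ndvd : (m.+1 %% 2 ^ m.+1 == 0) = false by apply: gtnNdvd => //; exact: ltn_expl.
  rewrite big_ord_recr big_mkord Ndvd; exact: addn0.
apply: (recseq_sum (f := fun k s => F s %% 2 ^ k.+1 == 0)) => //.
apply/recseq_eq0/recseq_mod; first exact: recseq_drop.
by apply: recseq_exp; [apply: recseq_const|apply/recseq_succ/recseq_var].
Qed.

Lemma recseq_behead_decode (F : seq nat -> nat) :
  recseq F -> recseq (fun s => code (behead (decode (F s)))).
Proof.
move=> rF.
apply: (recseq_ext (F := fun s => (F s %/ 2 ^ head 0 (decode (F s))).-1 %/ 2)).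
  move=> s; move: (F s) => m; rewrite -[m]decodeK codeK; case: (decode m) => [|n t] //=.
  by rewrite mulKn ?expn_gt0 //= -muln2 mulnK.
apply: recseq_div; last exact: recseq_const.
apply/recseq_pred/recseq_div => //; apply: recseq_exp; first exact: recseq_const.
exact: recseq_head_decode.
Qed.

Lemma recseq_drop_decode (F G : seq nat -> nat) : recseq F -> recseq G ->
  recseq (fun s => code (drop (G s) (decode (F s)))).
Proof.
move=> rF rG.
apply: (recseq_ext (F := fun s => iter (G s) (fun m => code (behead (decode m))) (F s))).
  move=> s; elim: (G s) => [|i IHi] /=; first by rewrite drop0 decodeK.
  by rewrite IHi codeK -drop1 drop_drop.
apply: (recseq_iter (f := fun m _ => code (behead (decode m)))) => //.
exact/recseq_behead_decode/recseq_var.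
Qed.

Lemma recseq_nth_decode (F G : seq nat -> nat) : recseq F -> recseq G ->
  recseq (fun s => nth 0 (decode (F s)) (G s)).
Proof.
move=> rF rG; have := recseq_head_decode (recseq_drop_decode rF rG).
by apply: recseq_ext => s; rewrite codeK -nth0 nth_drop addn0.
Qed.

Lemma size_decode_leq m : size (decode m) <= m.
Proof.
rewrite -{2}[m]decodeK; elim: (decode m) => //= n s IHs.
rewrite (leq_trans _ (leq_pmull _ _)) ?expn_gt0 // ltnS (leq_trans IHs) //.
by rewrite -addnn leq_addr.
Qed.

Lemma recseq_size_decode (F : seq nat -> nat) :
  recseq F -> recseq (fun s => size (decode (F s))).
Proof.
move=> rF.
apply: (recseq_ext (F := fun s => \sum_(i < F s) (0 < code (drop i (decode (F s)))))).
  move=> s; set m := F s; rewrite (eq_bigr (fun i : 'I_m => (i < size (decode m) : nat))).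
    by rewrite -big_mkcond (big_ord_narrow (size_decode_leq m)) /= sum1_card card_ord.
  move=> i _; rewrite -[i < _]subn_gt0 -size_drop; congr nat_of_bool.
  by case: (drop i _) => //= n t; rewrite muln_gt0 expn_gt0.
apply: (recseq_sum (f := fun i s => 0 < code (drop i (decode (F s))))) => //.
apply: recseq_ltn; first exact: recseq_const.
by apply: recseq_drop_decode; [apply: recseq_drop|apply: recseq_var].
Qed.

Lemma recseq_all_decode (P : nat -> seq nat -> bool) (F : seq nat -> nat) :
  recseq (fun s => P (nth 0 s 0) (drop 1 s)) -> recseq F ->
  recseq (fun s => all (P^~ s) (decode (F s))).
Proof.
move=> rP rF.
apply: (recseq_ext (F := fun s => [forall i : 'I_(size (decode (F s))),
    P (nth 0 (decode (F s)) i) s])).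
  move=> s; congr nat_of_bool; apply/forallP/(all_nthP 0) => [H i lt_i|H i].
    exact: (H (Ordinal lt_i)).
  exact: H.
apply: (recseq_forall (P := fun i s => P (nth 0 (decode (F s)) i) s)).
  apply: (recseq_let 1 (f := P)) => //.
  by apply: recseq_nth_decode; [apply: recseq_drop|apply: recseq_var].
exact: recseq_size_decode.
Qed.

Lemma recseq_has_decode (P : nat -> seq nat -> bool) (F : seq nat -> nat) :
  recseq (fun s => P (nth 0 s 0) (drop 1 s)) -> recseq F ->
  recseq (fun s => has (P^~ s) (decode (F s))).
Proof.
move=> /recseq_neg rP rF.
apply: (recseq_ext (F := fun s => ~~ all (predC (P^~ s)) (decode (F s)))).
  move=> s; rewrite -has_predC; congr nat_of_bool.
  by apply: eq_has => i /=; rewrite negbK.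
apply: recseq_neg.
exact: (recseq_all_decode (P := fun i s => ~~ P i s)).
Qed.

(** * Evaluation of coded expressions *)

(** [m] is read as the code of an expression, without checking that it is one; the
literal (l, d) is compared with [r] through the listing of l alone, as a linear
order extends l exactly when it makes that list increasing ([cylinderE]). *)
Definition satisfies (r : rel nat) (m : nat) : bool :=
  has (fun c => all (fun q => head 0 (decode q) == sorted r (behead (decode q)))
    (decode c)) (decode m).

Definition digit (N c x : nat) : nat := (c %/ N ^ x) %% N.

(** [c] puts the label [x] at the position given by its digit of index [x]. *)
Definition digit_lt (N c : nat) : rel nat := relpre (digit N c) ltn.

(** The first condition singles out the codes of orders among all the integers
[c < N ^ N], which are the codes of all functions from labels to positions. *)
Definition arrangements (N m : nat) : nat :=
  \sum_(c < N ^ N)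
    ([forall x : 'I_N, [forall y : 'I_N,
        (digit N c x == digit N c y) ==> (x == y :> nat)]]
     && satisfies (digit_lt N c) m).

Lemma recseq_digit (N C X : seq nat -> nat) : recseq N -> recseq C -> recseq X ->
  recseq (fun s => digit (N s) (C s) (X s)).
Proof. by move=> rN rC rX; apply/recseq_mod/rN/recseq_div/recseq_exp/rX. Qed.

Lemma recseq_sorted_digit (N C Q : seq nat -> nat) :
  recseq N -> recseq C -> recseq Q ->
  recseq (fun s => sorted (digit_lt (N s) (C s)) (behead (decode (Q s)))).
Proof.
move=> rN rC rQ.
apply: (recseq_ext (F := fun s => [forall i : 'I_(size (decode (Q s)) - 2),
    digit (N s) (C s) (nth 0 (decode (Q s)) i.+1)
      < digit (N s) (C s) (nth 0 (decode (Q s)) i.+2)])).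
  move=> s; congr nat_of_bool.
  have E i : (i.+1 < size (behead (decode (Q s)))) = (i < size (decode (Q s)) - 2).
    by rewrite size_behead -subn1 !ltn_subRL !add1n.
  apply/forallP/(sortedP 0) => [H i|H i]; last first.
    by have := H i; rewrite E ltn_ord !nth_behead; apply.
  by rewrite E => lt_i; rewrite !nth_behead; apply: (H (Ordinal lt_i)).
apply: (recseq_forall (P := fun i s => digit (N s) (C s) (nth 0 (decode (Q s)) i.+1)
      < digit (N s) (C s) (nth 0 (decode (Q s)) i.+2))).
  have [rN1 rC1 rQ1] := And3 (recseq_drop 1 rN) (recseq_drop 1 rC) (recseq_drop 1 rQ).
  by apply: recseq_ltn; apply: recseq_digit => //; apply: recseq_nth_decode => //;
    do !apply: recseq_succ; apply: recseq_var.
by apply: recseq_sub (recseq_const 2); apply: recseq_size_decode.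
Qed.

Lemma recseq_satisfies_digit (N C F : seq nat -> nat) :
  recseq N -> recseq C -> recseq F ->
  recseq (fun s => satisfies (digit_lt (N s) (C s)) (F s)).
Proof.
move=> rN rC rF.
apply: (recseq_has_decode (P := fun c s => all (fun q => head 0 (decode q) ==
  sorted (digit_lt (N s) (C s)) (behead (decode q))) (decode c))) => //.
apply: (recseq_all_decode (P := fun q s => head 0 (decode q) ==
  sorted (digit_lt (N (drop 1 s)) (C (drop 1 s))) (behead (decode q)))); last first.
  exact: recseq_var.
apply: recseq_eq; first exact/recseq_head_decode/recseq_var.
by apply: recseq_sorted_digit (recseq_drop 1 (recseq_drop 1 rN))
  (recseq_drop 1 (recseq_drop 1 rC)) (recseq_var 0).
Qed.

Lemma recseq_arrangements (N F : seq nat -> nat) :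
  recseq N -> recseq F -> recseq (fun s => arrangements (N s) (F s)).
Proof.
move=> rN rF.
have rN1 := recseq_drop 1 rN; have rN2 := recseq_drop 1 rN1.
have rN3 := recseq_drop 1 rN2.
have v0 := recseq_var 0; have v1 := recseq_drop 1 v0.
have v2 := recseq_drop 1 v1.
apply: (recseq_sum (f := fun c s =>
    ([forall x : 'I_(N s), [forall y : 'I_(N s),
       (digit (N s) c x == digit (N s) c y) ==> (x == y :> nat)]]
     && satisfies (digit_lt (N s) c) (F s)))); last exact: recseq_exp.
apply: recseq_and; last first.
  by apply: recseq_satisfies_digit => //; apply: recseq_drop.
apply: (recseq_forall (P := fun x s => [forall y : 'I_(N (drop 1 s)),
  (digit (N (drop 1 s)) (nth 0 s 0) x == digit (N (drop 1 s)) (nth 0 s 0) y)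
    ==> (x == y :> nat)])) => //.
apply: (recseq_forall (P := fun y s =>
  (digit (N (drop 1 (drop 1 s))) (nth 0 (drop 1 s) 0) (nth 0 s 0)
     == digit (N (drop 1 (drop 1 s))) (nth 0 (drop 1 s) 0) y)
    ==> (nth 0 s 0 == y :> nat))) => //.
by apply: recseq_imply; apply: recseq_eq => //; apply: recseq_digit.
Qed.

Lemma satisfies_code (r : rel nat) (e : expression) :
  satisfies r (code_expression e)
  = has (all (fun q => q.2 == sorted r (listing q.1))) e.
Proof.
rewrite /satisfies codeK has_map; apply: eq_has => c /=.
rewrite codeK all_map; apply: eq_all => q /=.
by rewrite codeK /=; case: q.2; case: sorted.
Qed.

(** The entries of a list are smaller than its code, so that the labels are smaller
than the code of the literal, of the clause and of the expression; this is why the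
code of the expression can serve as the bound on its labels. *)
Lemma satisfies_eq_in (r r' : rel nat) (m : nat) :
  {in gtn m &, r =2 r'} -> satisfies r m = satisfies r' m.
Proof.
move=> rr'; apply: eq_in_has => c /(allP (gtn_decode m)) lt_cm.
apply: eq_in_all => q /(allP (gtn_decode c)) lt_qc.
congr (_ == nat_of_bool _).
apply: (eq_in_sorted (P := gtn m)) => //.
apply/allP => x /mem_behead /(allP (gtn_decode q)) lt_xq.
exact: ltn_trans lt_xq (ltn_trans lt_qc lt_cm).
Qed.

Lemma lt_M_total_order (xi : M) : strict_total_on predT (lt_M xi).
Proof. exact: (set_mem (valP xi)). Qed.

Lemma lt_M_irr (xi : M) : irreflexive (lt_M xi).
Proof. by case: (lt_M_total_order xi) => irr _ _ x; apply: irr. Qed.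

Lemma lt_M_trans (xi : M) : transitive (lt_M xi).
Proof. by case: (lt_M_total_order xi) => _ tr _ y x z; apply: tr. Qed.

Lemma lt_M_total (xi : M) x y : x != y -> lt_M xi x y || lt_M xi y x.
Proof. by case: (lt_M_total_order xi) => _ _ tot; apply: tot. Qed.

Lemma sorted_listing (l : Mf) :
  sorted (fun x y => (x == y) || fo_lt l x y) (listing l).
Proof.
case: l => D r [irr tr tot]; rewrite /listing /=.
apply: (@sort_sorted_in _ [in D] (fun x y => (x == y) || r x y)); last exact/allP.
move=> x y xD yD /=; have [//|/= xy] := eqVneq x y.
by have /orP[->|->] := tot x y xD yD xy; rewrite ?orbT.
Qed.

Lemma mem_listing (l : Mf) : listing l =i fo_dom l.
Proof. exact: mem_sort. Qed.

Lemma uniq_listing (l : Mf) : uniq (listing l).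
Proof. by rewrite sort_uniq fset_uniq. Qed.

(** If the listing is increasing for [xi] and [x] precedes [y] in l, then [x] comes
before [y] in the listing, for otherwise l would also put [y] before [x]. *)
Lemma cylinderE (l : Mf) (xi : M) :
  cylinder l xi <-> sorted (lt_M xi) (listing l).
Proof.
have [irr tr tot] := fo_total l; have lP := mem_listing l.
split=> [xi_l|xi_l x y xD yD lt_xy].
  apply/(sortedP 0) => i lt_i.
  have /(sortedP 0)/(_ i lt_i) := sorted_listing l.
  have xD : nth 0 (listing l) i \in fo_dom l by rewrite -lP mem_nth // ltnW.
  have yD : nth 0 (listing l) i.+1 \in fo_dom l by rewrite -lP mem_nth.
  rewrite nth_uniq ?uniq_listing ?(ltnW lt_i) // ltn_eqF //=.
  exact: xi_l.
have xL : x \in listing l by rewrite lP.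
have yL : y \in listing l by rewrite lP.
case: (ltngtP (index x (listing l)) (index y (listing l))) => [lt_i|lt_i|eq_i].
- exact: (sorted_ltn_index (@lt_M_trans xi)) lt_i.
- have leT_tr : {in listing l & &, transitive (fun x y => (x == y) || fo_lt l x y)}.
    move=> b a c; rewrite !lP => bD aD cD /orP[/eqP -> //|ab] /orP[/eqP <-|bc].
      by rewrite ab orbT.
    by rewrite (tr _ _ _ bD aD cD ab bc) orbT.
  have := sorted_ltn_index_in leT_tr (sorted_listing l) y x yL xL lt_i.
  case/orP=> [/eqP eq_yx|/(tr _ _ _ yD xD xD lt_xy)]; last by rewrite irr.
  by move: lt_xy; rewrite eq_yx irr.
- have eq_xy : x = y by rewrite -(nth_index x xL) eq_i nth_index.
  by move: lt_xy; rewrite eq_xy irr.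
Qed.

Lemma expression_setE (e : expression) (xi : M) :
  expression_set e xi <-> satisfies (lt_M xi) (code_expression e).
Proof.
rewrite satisfies_code /expression_set.
have litE q : literal_set q xi <-> q.2 == sorted (lt_M xi) (listing q.1).
  case: q => l [] /=; rewrite /literal_set /=; last rewrite eq_sym eqbF_neg.
    by rewrite cylinderE; case: sorted.
  by rewrite /setC /= cylinderE; split=> /negP.
have clauseE (c : seq literal) : (\big[setI/setT]_(q <- c) literal_set q)%classic xi
  <-> all (fun q => q.2 == sorted (lt_M xi) (listing q.1)) c.
  elim: c => [|q c IHc] /=; first by rewrite big_nil.
  by rewrite big_cons /setI /= IHc litE; split=> /andP.
elim: e => [|c e IHe] /=; first by rewrite big_nil.
by rewrite big_cons /setU /= IHe clauseE; split=> /orP.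
Qed.

(** * Orders coded by digits *)

(** Only the values of [ext f] below [n.+1] matter. *)
Definition ext n (f : {ffun 'I_n.+1 -> 'I_n.+1}) : nat -> nat :=
  fun x => f (inord x).

Definition digits n (c : nat) : {ffun 'I_n.+1 -> 'I_n.+1} :=
  [ffun x : 'I_n.+1 => inord (digit n.+1 c x)].

Lemma digitsE n c (x : 'I_n.+1) : digits n c x = digit n.+1 c x :> nat.
Proof. by rewrite ffunE inordK // ltn_pmod. Qed.

Lemma digit_inj N k c d : 0 < N -> c < N ^ k -> d < N ^ k ->
  (forall x, x < k -> digit N c x = digit N d x) -> c = d.
Proof.
move=> N_gt0; elim: k c d => [|k IHk] c d.
  by rewrite expn0 !ltnS !leqn0 => /eqP -> /eqP ->.
rewrite expnS => lt_c lt_d eq_cd.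
rewrite (divn_eq c N) (divn_eq d N).
have := eq_cd 0 isT; rewrite /digit expn0 !divn1 => ->.
congr (_ * N + _); apply: IHk; rewrite ?ltn_divLR // 1?mulnC // => x lt_xk.
by have := eq_cd x.+1 lt_xk; rewrite /digit expnS !divnMA.
Qed.

Lemma digits_bij n : bijective (fun c : 'I_(n.+1 ^ n.+1) => digits n c).
Proof.
apply: inj_card_bij; last by rewrite card_ffun !card_ord.
move=> c d eq_cd; apply: val_inj.
apply: (@digit_inj n.+1 n.+1 _ _ isT (valP c) (valP d)) => x lt_x.
by rewrite -!(digitsE _ (Ordinal lt_x)) eq_cd.
Qed.

Lemma arrangementsE n m : m <= n.+1 ->
  arrangements n.+1 m =
  #|[set f : {ffun 'I_n.+1 -> 'I_n.+1} |
      injectiveb f & satisfies (relpre (ext f) ltn) m]|.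
Proof.
move=> le_mn; rewrite -sum1dep_card (reindex _ (onW_bij _ (digits_bij n))) /=.
rewrite [RHS]big_mkcond /=; apply: eq_bigr => c _.
have -> : satisfies (digit_lt n.+1 c) m
    = satisfies (relpre (ext (digits n c)) ltn) m.
  apply: satisfies_eq_in => x y lt_x lt_y /=.
  by rewrite /digit_lt /ext /= !digitsE !inordK // (leq_trans _ le_mn).
have -> : [forall x : 'I_n.+1, [forall y : 'I_n.+1,
    (digit n.+1 c x == digit n.+1 c y) ==> (x == y :> nat)]] = injectiveb (digits n c).
  apply/forallP/injectiveP => [H x y eq_xy|inj_c x].
    have /forallP/(_ y)/implyP := H x; rewrite -!digitsE eq_xy.
    by move=> /(_ (eqxx _))/eqP/val_inj.
  apply/forallP => y; apply/implyP; rewrite -!digitsE => /eqP/val_inj/inj_c ->.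
  exact: eqxx.
by case: (_ && _).
Qed.

(** * Cells of the space of total orders *)

Local Open Scope classical_set_scope.

(** For an injective [f], this is the cylinder of the order of [0, ..., n] in which
[f x] is the position of [x]. *)
Definition order_cell n (f : {ffun 'I_n.+1 -> 'I_n.+1}) : set M :=
  [set xi | forall x y : 'I_n.+1, lt_M xi x y = (f x < f y)].

Definition rank n (xi : M) : {ffun 'I_n.+1 -> 'I_n.+1} :=
  [ffun x : 'I_n.+1 => inord #|[set y : 'I_n.+1 | lt_M xi y x]%SET|].

Lemma rankE n (xi : M) (x : 'I_n.+1) :
  rank n xi x = #|[set y : 'I_n.+1 | lt_M xi y x]%SET| :> nat.
Proof.
rewrite ffunE inordK // -[X in _ < X](card_ord n.+1) -cardsT proper_card //.
by rewrite properE finset.subsetT; apply/subsetPn; exists x; rewrite !inE // lt_M_irr.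
Qed.

Lemma rank_cell n (xi : M) : order_cell (rank n xi) xi.
Proof.
have rk_lt (x y : 'I_n.+1) : lt_M xi x y -> rank n xi x < rank n xi y.
  move=> lt_xy; rewrite !rankE proper_card // properE; apply/andP; split.
    by apply/fintype.subsetP => z; rewrite !inE => /lt_M_trans; apply.
  by apply/subsetPn; exists x; rewrite !inE ?lt_M_irr.
move=> x y; apply/idP/idP; first exact: rk_lt.
apply: contraLR => Nlt_xy; rewrite -leqNgt.
have [->//|ne_xy] := eqVneq x y.
by have := lt_M_total xi ne_xy; rewrite (negbTE Nlt_xy) => /rk_lt/ltnW.
Qed.

Lemma rank_inj n (xi : M) : injective (rank n xi).
Proof.
move=> x y eq_rk; apply/eqP/negPn/negP => ne_xy.
by have := lt_M_total xi ne_xy; rewrite !rank_cell eq_rk ltnn.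
Qed.

(** Positions are determined by the order: [f x] is the number of positions below
it, all of which are taken by labels smaller than [x].  Together with [rank_cell]
and [rank_inj], this says that the cells of the injective functions partition the
space. *)
Lemma cell_rank n (f : {ffun 'I_n.+1 -> 'I_n.+1}) (xi : M) :
  injective f -> order_cell f xi -> f = rank n xi.
Proof.
move=> inj_f xi_f; apply/ffunP => x; apply: val_inj; rewrite /= rankE.
rewrite -(card_imset _ inj_f).
transitivity #|[set z : 'I_n.+1 | z < f x]%SET|.
  rewrite -sum1dep_card (big_ord_narrow (ltnW (ltn_ord (f x)))) /=.
  by rewrite sum1_card card_ord.
apply: eq_card => z; rewrite inE; apply/idP/imsetP => [lt_z|[y]].
  have [g fK gK] := injF_bij inj_f.
  by exists (g z); rewrite ?gK // inE xi_f gK.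
by rewrite inE xi_f => ? ->.
Qed.

Lemma open_lt_M (x y : nat) : open [set xi : M | lt_M xi x y].
Proof.
rewrite /lt_M /lt_of; case: insubP => [p _ _|_]; last first.
  rewrite (_ : [set _ | _] = set0); first exact: open0.
  by apply/seteqP; split.
have cont : continuous (fun xi : M => val xi p).
  move=> xi; apply: (@continuous_comp _ _ _
    (fun xi : M => val xi : {ptws offdiag -> bool})
    (fun eta : {ptws offdiag -> bool} => eta p)).
    exact: initial_continuous.
  exact: (@proj_continuous _ (fun=> bool) p).
have /continuousP/(_ [set true] (discrete_open _)) := cont.
by [].
Qed.

(** A cell is a finite intersection of sets given by the relative position of two
labels, and these sets are open or have an open complement. *)
Lemma measurable_cell n (f : {ffun 'I_n.+1 -> 'I_n.+1}) :
  measurable (order_cell f : set BorelM).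
Proof.
rewrite (_ : order_cell f = \bigcap_(p in [set: 'I_n.+1 * 'I_n.+1])
    [set xi : M | lt_M xi p.1 p.2 = (f p.1 < f p.2)]).
  apply: fin_bigcap_measurable => // p _.
  have mlt : measurable ([set xi : M | lt_M xi p.1 p.2] : set BorelM).
    by apply: sub_sigma_algebra; apply: open_lt_M.
  case: (f _ < _) => //.
  rewrite (_ : [set _ | _] = ~` [set xi : M | lt_M xi p.1 p.2]).
    exact: (measurableC mlt).
  by apply/seteqP; split=> xi /= => [->|/negP/negbTE].
by apply/seteqP; split=> xi xi_f => [p _|x y]; [apply: xi_f|apply: (xi_f (x, y))].
Qed.

Lemma lt_of_val (xi : offdiag -> bool) (p : offdiag) :
  lt_of xi (val p).1 (val p).2 = xi p.
Proof. by rewrite /lt_of -surjective_pairing valK. Qed.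

Lemma lt_M_act (s : Sinfty) (xi : M) x y :
  lt_M (act s xi) x y = lt_M xi (sinv s x) (sinv s y).
Proof. exact: lt_of_act_fun. Qed.

Lemma lt_M_inj (xi eta : M) : lt_M xi =2 lt_M eta -> xi = eta.
Proof.
move=> eq_lt; apply: val_inj; apply/funext => p.
by rewrite -!lt_of_val; apply: eq_lt.
Qed.

Definition inverse (s : Sinfty) : Sinfty := MkSinfty (sinvK s) (sfunK s).

Definition extend_perm n (p : {perm 'I_n}) (x : nat) : nat :=
  if insub x is Some i then p i else x.

Lemma extend_perm_ord n (p : {perm 'I_n}) (i : 'I_n) : extend_perm p i = p i.
Proof. by rewrite /extend_perm valK. Qed.

Lemma extend_permK n (p : {perm 'I_n}) : cancel (extend_perm p) (extend_perm (p^-1)%g).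
Proof.
move=> x; rewrite {2}/extend_perm; case: insubP => [i _ <-|ge_x].
  by rewrite extend_perm_ord permK.
by rewrite /extend_perm insubN.
Qed.

Definition Sinfty_of_perm n (p : {perm 'I_n}) : Sinfty.
Proof.
exists (extend_perm p) (extend_perm (p^-1)%g); first exact: extend_permK.
by rewrite -{2}[p]invgK; apply: extend_permK.
Defined.

(** Renaming each label by its position turns the cell of [f] into the cell of the
natural order, so that all the cells have the same measure. *)
Lemma act_cell n (f : {ffun 'I_n.+1 -> 'I_n.+1}) (inj_f : injective f) :
  act (Sinfty_of_perm (perm inj_f)) @` order_cell f
  = order_cell [ffun x : 'I_n.+1 => x].
Proof.
set s := Sinfty_of_perm _.
apply/seteqP; split=> [_ [xi xi_f <-] x y|xi xi_id].
  by rewrite lt_M_act /= !extend_perm_ord xi_f !ffunE -!(permE inj_f) !permKV.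
exists (act (inverse s) xi) => [x y|]; last first.
  apply: lt_M_inj => x y; rewrite !lt_M_act.
  by congr (lt_M xi _ _); apply: (sinvK s).
by rewrite lt_M_act /= !extend_perm_ord !permE xi_id !ffunE.
Qed.

(** * Measure of the cells *)

Lemma measure_cells (R : realType) (mu : probability BorelM R) n
    (P : pred {ffun 'I_n.+1 -> 'I_n.+1}) :
  glasner_weiss mu -> (forall f, P f -> injective f) ->
  mu (\bigcup_(f in [set` P]) order_cell f) =
  ((#|P|)%:R * fine (mu (order_cell [ffun x : 'I_n.+1 => x])))%:E.
Proof.
move=> mu_inv P_inj; rewrite measure_fin_bigcup //=; last 2 first.
- move=> f g /= Pf Pg [xi [xi_f xi_g]].
  by rewrite (cell_rank (P_inj _ Pf) xi_f) -(cell_rank (P_inj _ Pg) xi_g).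
- by move=> f _; apply: measurable_cell.
rewrite -(@bigfs _ _ _ _ (index_enum _)) ?index_enum_uniq //=; last first.
  by move=> f _; rewrite mem_index_enum.
rewrite (eq_bigr (fun=> mu (order_cell [ffun x : 'I_n.+1 => x]))) => [|f Pf].
  rewrite -[X in (\sum_(i | _) X)%E](fineK (fin_num_measure _ _ _)); last first.
    exact: measurable_cell.
  by rewrite sumEFin sumr_const mulr_natl.
rewrite -(act_cell (P_inj _ Pf)) mu_inv //; exact: measurable_cell.
Qed.

(** All the cells together have mass 1, and there are [(n.+1)`!] of them. *)
Lemma measure_cell (R : realType) (mu : probability BorelM R) n :
  glasner_weiss mu ->
  fine (mu (order_cell [ffun x : 'I_n.+1 => x])) = ((n.+1)`!%:R^-1)%R.
Proof.
move=> mu_inv.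
have := measure_cells (P := fun f : {ffun 'I_n.+1 -> 'I_n.+1} => injectiveb f) mu_inv
  (fun f => elimT (@injectiveP _ _ f)).
rewrite (_ : \bigcup_(f in _) _ = setT); last first.
  apply/seteqP; split=> // xi _; exists (rank n xi); last exact: rank_cell.
  exact/injectiveP/rank_inj.
rewrite probability_setT => -[].
rewrite -[#|_|]cardsE card_inj_ffuns !card_ord ffactnn => E.
apply: (@mulfI _ (n.+1)`!%:R%R); first by rewrite pnatr_eq0 -lt0n fact_gt0.
by rewrite -E mulfV // pnatr_eq0 -lt0n fact_gt0.
Qed.

Lemma measure_expression (R : realType) (mu : probability BorelM R)
    (e : expression) (n := code_expression e) :
  glasner_weiss mu ->
  mu (expression_set e) = ((arrangements n.+1 n)%:R / (n.+1)`!%:R)%:E.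
Proof.
move=> mu_inv; rewrite arrangementsE // -(measure_cell n mu_inv) cardsE.
rewrite -(measure_cells mu_inv) => [|f /andP[/injectiveP //]].
congr (mu _); apply/seteqP; split=> xi.
  move/expression_setE => sat_xi; exists (rank n xi); last exact: rank_cell.
  apply/andP; split; first exact/injectiveP/rank_inj.
  move: sat_xi; rewrite -/n (@satisfies_eq_in _ (relpre (ext (rank n xi)) ltn)) //.
  move=> x y lt_x lt_y /=.
  by rewrite /ext -rank_cell !inordK // ltnW.
move=> [f /andP[inj_f sat_f] xi_f]; apply/expression_setE; rewrite -/n.
rewrite (@satisfies_eq_in _ (relpre (ext f) ltn)) // => x y lt_x lt_y /=.
by rewrite /ext -xi_f !inordK // ltnW.
Qed.

(** * Dyadic approximation *)

Theorem theorem4 (R : realType) (mu : probability BorelM R) (T : nat -> set M) :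
  glasner_weiss mu ->
  recursive_representation T ->
  exists beta : nat -> nat -> rat,
    recursive_dyadic beta /\
    forall i k : nat,
      (`|mu (T i) - (ratr (beta i k))%:E| < ((2%:R ^- k)%R : R)%:E)%E.
Proof.
move=> mu_inv [_ [f [rec_f fE]]].
pose F (s : seq nat) := f [tuple nth 0 s 0].
have rF : recseq F by exact: recseq_recursive1.
pose A (s : seq nat) := arrangements (F s).+1 (F s).
pose B (s : seq nat) := ((F s).+1)`!.
pose P (s : seq nat) := 2 ^ nth 0 s 1 * A s %/ B s.
have rP : recseq P.
  apply: recseq_div; last exact/recseq_fact/recseq_succ.
  apply: recseq_mul; first exact: (recseq_exp (recseq_const 2) (recseq_var 1)).
  by apply: recseq_arrangements => //; apply: recseq_succ.
(* [P] is the integer part of [2 ^ k] times the measure. *)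
exists (fun i k => (P [:: i; k])%:R / 2%:R ^+ k)%R; split.
  exists (fun=> 0), P, (fun v => nth 0 v 1); split.
  - exact: rec_zero.
  - exact: rP.
  - exact: recseq_var.
  - by move=> i k; rewrite expr0 mul1r.
move=> i k; have [e [f_i ->]] := fE i.
rewrite measure_expression // -f_i.
rewrite -EFinB abse_EFin lte_fin.
rewrite rmorphM fmorphV rmorphXn !rmorph_nat.
rewrite /P /A /B /F /=; set a := arrangements _ _; set b := _`!.
have b_gt0 : (0 < b%:R :> R)%R by rewrite ltr0n fact_gt0.
have t_gt0 : (0 < 2%:R ^+ k :> R)%R by rewrite exprn_gt0 // ltr0n.
have := divn_eq (2 ^ k * a) b; set q := _ %/ _; set r := _ %% _.
move=> /(congr1 (fun m => m%:R : R)%R).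
rewrite natrM natrD natrM natrX => E.
have lt_rb : (r%:R < b%:R :> R)%R by rewrite ltr_nat ltn_pmod // fact_gt0.
(* Dividing [2 ^ k * a = q * b + r] by [2 ^ k * b], the error is the fraction [r / b]
   of [2 ^- k]. *)
have -> : (a%:R / b%:R - q%:R / 2%:R ^+ k = (r%:R / b%:R) / 2%:R ^+ k :> R)%R.
  have -> : (r%:R = 2%:R ^+ k * a%:R - q%:R * b%:R :> R)%R by rewrite E addrC addKr.
  rewrite !mulrBl (mulfK (lt0r_neq0 b_gt0)) -[(_ * _ / b%:R)%R]mulrA.
  by rewrite [(_ * (_ / _))%R]mulrC (mulfK (lt0r_neq0 t_gt0)).
rewrite ger0_norm; last by rewrite !divr_ge0 ?ler0n // ltW.
by rewrite ltr_pdivrMr // mulVf ?lt0r_neq0 // ltr_pdivrMr // mul1r.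
Qed.
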